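(* Consider the normal means model $y=\beta+\varepsilon$, $\varepsilon\sim N(0,I_n)$, $\beta\in\mathcal B(n,s_n)$, with $\limsup_n s_n/n=\zeta\in[0,1)$. Let $c_1>2$ be a constant and suppose $\Omega_o(c_1)$ is nonempty. Then there exist a constant $C>0$ (not depending on $n$) and a positive sequence $\epsilon_n\to0$ such that for all sufficiently large $n$ $$\inf_{\widehat\beta\in\Omega_o(c_1)}\ \sup_{\beta\in\mathcal B(n,s_n)}\mathrm{FDR}(\widehat\beta)\ \le\ C\,(s_n/n)^{(c_1-2-\epsilon_n)/2}.$$
   Context: $1\le s_n\le n$ are integers. $\mathcal B(n,s_n)=\{\beta\in\mathbb R^n:\|\beta\|_0\le s_n\}$, where $\|\beta\|_0$ is the number of nonzero entries. An estimator is any (measurable) function $\widehat\beta=\widehat\beta(y)\in\mathbb R^n$; it is allowed to depend on $s_n$. $E_\beta$ is expectation over $y\sim N(\beta,I_n)$. $\mathrm{FP}(\widehat\beta)=|\{j:\widehat\beta_j\ne0,\beta_j=0\}|$ and $\mathrm{TP}(\widehat\beta)=|\{j:\widehat\beta_j\ne0,\beta_j\ne0\}|$; $\mathrm{FDP}(\widehat\beta)=\mathrm{FP}/(\mathrm{FP}+\mathrm{TP})$ (with $0/0=0$) and $\mathrm{FDR}(\widehat\beta)=E_\beta(\mathrm{FDP}(\widehat\beta))$. The class of rate optimal estimators with multiplicative constant $c_1$ is $$\Omega_o(c_1)=\Big\{\widehat\beta:\ \sup_{\beta\in\mathcal B(n,s_n)}E_\beta\|\beta-\widehat\beta\|^2\le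 c_1s_n\log(n/s_n)\Big\}.$$ *)

(* Defs.v *)
From HB Require Import structures.
From mathcomp Require Import all_boot all_order all_algebra.
From mathcomp Require Import all_classical all_reals all_analysis.

Set Implicit Arguments.
Unset Strict Implicit.
Unset Printing Implicit Defensive.

Import Order.TTheory GRing.Theory Num.Theory.
Import numFieldNormedType.Exports.

Local Open Scope classical_set_scope.
Local Open Scope ring_scope.

(* R^n is the type n.-tuple R, with its product sigma-algebra. *)

Section gaussian.
Variable R : realType.

(* measurableTypeR R is R with the Borel sigma-algebra; it is the type on which
   normal_prob is a measure, with the same measurable sets as R. *)
Definition tcons n (p : measurableTypeR R * n.-tuple R) : n.+1.-tuple R :=
  [tuple of (p.1 : R) :: p.2].

Lemma measurable_tcons n :
  measurable_fun [set: measurableTypeR R * n.-tuple R] (@tcons n).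
Proof.
apply: (@measurable_cons _ _ _ R (fun p => p.1 : R) n snd) => //.
move=> _ A mA; exact: (@measurable_fst _ _ (measurableTypeR R)).
Qed.

HB.instance Definition _ n :=
  isMeasurableFun.Build _ _ (measurableTypeR R * n.-tuple R)%type
    (n.+1.-tuple R) (@tcons n) (@measurable_tcons n).

Definition prob_cons n (P : probability (measurableTypeR R) R)
    (Q : probability (n.-tuple R) R) : probability (n.+1.-tuple R) R :=
  distribution (P \x Q)%E (@tcons n).

(* N(b, I_n), as the product measure N(b_0, 1) x ... x N(b_(n-1), 1). The
   second argument of normal_prob is the standard deviation. *)
Fixpoint gaussian n : n.-tuple R -> probability (n.-tuple R) R :=
  match n with
  | 0 => fun=> @dirac _ _ ([tuple] : 0.-tuple R) R
  | m.+1 => fun b =>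
      @prob_cons m (normal_prob (thead b) 1) (gaussian (behead_tuple b))
  end.

Lemma gaussian_rectangle n (b : n.-tuple R) (A : 'I_n -> set R) :
  (forall j, measurable (A j)) ->
  gaussian b [set y | forall j, A j (tnth y j)] =
  (\prod_(j < n) normal_prob (tnth b j) 1 (A j))%E.
Proof.
elim: n b A => [|n IH] b A mA.
  by rewrite big_ord0 /= diracE mem_set//; case.
rewrite big_ord_recl /= /prob_cons /distribution /pushforward.
have -> : @tcons n @^-1` [set y | forall j, A j (tnth y j)] =
    A ord0 `*` [set y | forall j, A (lift ord0 j) (tnth y j)].
  apply/seteqP; split => [[x y] /= h|[x y] /= [h0 h] j].
    split; first exact: (h ord0).
    by move=> j; have := h (lift ord0 j); rewrite tnthS.
  by case: (unliftP ord0 j) => [k ->|->//]; rewrite tnthS.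
rewrite product_measure1E//; last first.
  rewrite (_ : [set _ | _] =
      \bigcap_j ((fun y : n.-tuple R => tnth y j) @^-1` A (lift ord0 j))).
    apply: fin_bigcap_measurable => // j _.
    by rewrite -[X in measurable X]setTI; exact: measurable_tnth.
  by apply/seteqP; split => [y h j _|y h j]; exact: h.
  exact: (mA ord0).
congr (_ * _)%E.
apply: etrans (IH (behead_tuple b) (fun j => A (lift ord0 j)) _) _ => //.
by apply: eq_bigr => j _; rewrite [in RHS](tuple_eta b) tnthS.
Qed.

End gaussian.

Section sparse_estimation.
Variables (R : realType) (n : nat).
Implicit Types (b x : n.-tuple R) (bhat : n.-tuple R -> n.-tuple R).

Definition l0norm b : nat := #|[pred j | tnth b j != 0]|.

Definition sparse (s : nat) : set (n.-tuple R) := [set b | (l0norm b <= s)%N].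

Definition sqdist b x : R := \sum_(j < n) (tnth b j - tnth x j) ^+ 2.

Definition FP b x : nat := #|[pred j | (tnth x j != 0) && (tnth b j == 0)]|.

Definition TP b x : nat := #|[pred j | (tnth x j != 0) && (tnth b j != 0)]|.

(* The convention 0 / 0 = 0 is that of division in a field. *)
Definition FDP b x : R := (FP b x)%:R / (FP b x + TP b x)%:R.

Definition FDR b bhat : \bar R := 'E_(gaussian b)[fun y => FDP b (bhat y)].

Definition risk b bhat : \bar R := 'E_(gaussian b)[fun y => sqdist b (bhat y)].

Definition rate_optimal (s : nat) (c1 : R) : set (n.-tuple R -> n.-tuple R) :=
  [set bhat | measurable_fun [set: n.-tuple R] bhat /\
    (ereal_sup [set risk b bhat | b in sparse s] <=
      (c1 * s%:R * ln (n%:R / s%:R))%:E)%E].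

End sparse_estimation.

(* Main.v *)
Require Import Defs.
From HB Require Import structures.
From mathcomp Require Import all_boot all_order all_algebra.
From mathcomp Require Import all_classical all_reals all_analysis.
From mathcomp Require Import measurable_realfun.
From mathcomp Require Import ring lra.

(** Write L = log (n / s). When L is bounded, every rate optimal estimator will
do, because FDR <= 1 and (s / n)^((c1 - 2) / 2) is bounded below. When L is
large, use soft thresholding with a data-driven threshold: the squared
thresholds are A + 4 i with A = c1 L - 15, and the smallest one exceeded by at
least s / 2^i coordinates is selected.

Selecting threshold i means at least s / 2^i discoveries, so FDP is at most the
sum over i of 2^i / s times the number of nulls beyond threshold i, whose
expectation is a geometric series of order (n / s) exp (- A / 2), that is
(s / n)^((c1 - 2) / 2).

The error at coordinate j is the clipped observation minus the noise. The
clipped observation is nondecreasing in y_j, even though the threshold depends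
on y_j, so reflecting the noise shows that the cross term only helps and the
risk at j is at most E(noise^2) + E(clipped^2). Since fewer than s / 2^i
coordinates exceed each threshold i below the selected one, the squared clipped
observations add up to at most s (A + 8) over the support, and the total risk
stays below c1 s L with no loss in the constant. *)

Set Implicit Arguments.
Unset Strict Implicit.
Unset Printing Implicit Defensive.

Import Order.TTheory GRing.Theory Num.Theory.
Import numFieldNormedType.Exports.

Local Open Scope classical_set_scope.
Local Open Scope ring_scope.

Lemma measurable_fun_natr_bool d (T : measurableType d) (R : realType)
    (f : T -> bool) : measurable_fun [set: T] f ->
  measurable_fun [set: T] (fun x => (f x)%:R : R).
Proof.
move=> mf; rewrite (_ : (fun x => _) = fun x => if f x then 1 else 0 : R).
  exact: measurable_fun_ifT.
by apply/funext => x; case: (f x).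
Qed.

(** * The one-dimensional normal law: reflection, second moment, tails *)

Section normal_prob_lemmas.
Variable R : realType.
Local Notation mu := (@lebesgue_measure R).
Implicit Types (m s b t c : R) (A : set R).

(** The Radon-Nikodym derivative of [normal_prob] and [normal_pdf] have the same integral over every
    measurable set, hence agree almost everywhere. *)
Lemma ge0_integral_normal_prob m s (f : measurableTypeR R -> \bar R) :
  measurable_fun [set: measurableTypeR R] f -> (forall x, (0 <= f x)%E) ->
  (\int[normal_prob m s]_x f x = \int[mu]_x (f x * (normal_pdf m s x)%:E))%E.
Proof.
move=> mf f0; have dom := @normal_prob_dominates R m s.
rewrite -(Radon_Nikodym_SigmaFinite.change_of_variables dom)//.
have mg := measurable_int _ (Radon_Nikodym_SigmaFinite.f_integrable dom).
have mpdf : measurable_fun [set: measurableTypeR R]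
    (fun x => (normal_pdf m s x)%:E).
  apply/measurable_EFinP; exact: measurable_normal_pdf.
apply: ae_eq_integral => //; [exact: emeasurable_funM..|].
apply: ae_eqe_mul2l; apply: integral_ae_eq => //.
- exact: Radon_Nikodym_SigmaFinite.f_integrable.
- by move=> E _ mE; rewrite -Radon_Nikodym_SigmaFinite.f_integral.
Qed.

(** By uniqueness of Lebesgue measure, half-open intervals suffice; reflection moves the closed end
    to the other side and keeps the length. *)
Lemma lebesgue_measure_reflection c (A : set (measurableTypeR R)) :
  measurable A ->
  pushforward mu (fun x : measurableTypeR R => (c - x : measurableTypeR R)) A =
  mu A.
Proof.
have mr : measurable_fun [set: measurableTypeR R]
    (fun x : measurableTypeR R => (c - x : measurableTypeR R)).
  exact: measurable_funB.
pose H := isMeasurableFun.Build _ _ _ _ _ mr.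
pose rho : {mfun measurableTypeR R >-> measurableTypeR R} :=
  HB.pack (fun x : measurableTypeR R => (c - x : measurableTypeR R)) H.
move=> mA; apply/esym/(@lebesgue_measure_unique _ (pushforward mu rho)) => //=.
move=> _ [[a b]] _ <-.
rewrite /pushforward (_ : _ @^-1` _ = `[c - b, c - a[%classic).
  rewrite !lebesgue_measure_itv/= !lte_fin ltrD2l ltrN2.
  by case: ifP => // _; rewrite -!EFinB; congr EFin; ring.
by apply/seteqP; split => x /=; rewrite !in_itv/= => /andP[h1 h2];
  apply/andP; split; lra.
Qed.

Lemma normal_prob_reflection b A : measurable A ->
  normal_prob b 1 ((fun x => 2 * b - x) @^-1` A) = normal_prob b 1 A.
Proof.
move=> mA.
have mr : measurable_fun [set: measurableTypeR R]
    (fun x : measurableTypeR R => (2 * b - x : measurableTypeR R)).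
  exact: measurable_funB.
have mpdf : measurable_fun [set: measurableTypeR R]
    (fun x => (normal_pdf b 1 x)%:E).
  apply/measurable_EFinP; exact: measurable_normal_pdf.
have sq (u v : R) : (2 * v - u - v) ^+ 2 = (u - v) ^+ 2 by ring.
rewrite /normal_prob.
pose rho : measurableTypeR R -> measurableTypeR R := fun x => 2 * b - x.
transitivity (\int[pushforward mu rho]_(x in A) (normal_pdf b 1 x)%:E)%E;
  last first.
  apply: eq_measure_integral => B mB _.
  exact: lebesgue_measure_reflection.
rewrite (@ge0_integral_pushforward _ _ _ _ _ rho mr).
- apply: eq_integral => x _; rewrite /= /rho; congr EFin.
  rewrite !(normal_pdfE _ (oner_neq0 R)) /normal_fun.
  by rewrite (sq x b).
- exact: mA.
- exact: measurable_funTS.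
- by move=> x _; rewrite lee_fin normal_pdf_ge0.
Qed.

(** A crude pointwise comparison: [u^2] times the density of deviation 1 is at most 6 times the
    density of deviation 2, because [expR (3/8 * u^2) >= 1 + 3/8 * u^2]. *)
Lemma integral_normal_prob_sqr_le b :
  (\int[normal_prob b 1]_y ((y - b) ^+ 2)%:E <= 6%:E)%E.
Proof.
have mpdf k : measurable_fun [set: measurableTypeR R]
    (fun x => (normal_pdf b k x)%:E).
  apply/measurable_EFinP; exact: measurable_normal_pdf.
have msq : measurable_fun [set: measurableTypeR R]
    (fun y : measurableTypeR R => ((y - b) ^+ 2)%:E).
  by apply/measurable_EFinP/measurable_funX/measurable_funB.
rewrite ge0_integral_normal_prob//; last by move=> x; rewrite lee_fin sqr_ge0.
apply: (@le_trans _ _ (\int[mu]_x (6%:E * (normal_pdf b 2 x)%:E))%E);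
  last first.
  rewrite ge0_integralZl//.
    by rewrite integral_normal_pdf mule1.
  by move=> x _; rewrite lee_fin normal_pdf_ge0.
apply: ge0_le_integral => //.
- by move=> x _; rewrite mule_ge0// lee_fin ?sqr_ge0 ?normal_pdf_ge0.
- exact: emeasurable_funM.
- exact: emeasurable_funM.
move=> x _; rewrite -!EFinM lee_fin.
have n20 : (2 : R) != 0 by [].
rewrite (normal_pdfE _ (oner_neq0 R)) (normal_pdfE _ n20).
have -> : normal_peak (1 : R) = 2 * normal_peak 2.
  rewrite /normal_peak expr1n mul1r -mulrnAr sqrtrM ?sqr_ge0// sqrtr_sqr.
  by rewrite ger0_norm// invfM mulrA divff// mul1r.
rewrite /normal_fun; set u := x - b.
have -> : expR (- u ^+ 2 / (2 ^+ 2 *+ 2)) =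
    expR (- u ^+ 2 / (1 ^+ 2 *+ 2)) * expR (3 / 8 * u ^+ 2).
  by rewrite -expRD; congr expR; field.
have h := expR_ge1Dx (3 / 8 * u ^+ 2).
have p0 := @normal_peak_ge0 R 2; have u0 := sqr_ge0 u.
have e0 := expR_ge0 (- u ^+ 2 / (1 ^+ 2 *+ 2)).
set e := expR _ in e0 *; set f := expR _ in h *; set p := normal_peak 2 in p0 *.
have -> : u ^+ 2 * (2 * p * e) = (p * e) * (2 * u ^+ 2) by ring.
have -> : 6 * (p * (e * f)) = (p * e) * (6 * f) by ring.
by apply: ler_wpM2l; [exact: mulr_ge0|lra].
Qed.

(* Exponential tilting: beyond t the N(0,1) density loses exactly the factor
   exp(-t^2/2) against N(t,1) or N(-t,1), with no polynomial correction. *)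
Lemma normal_fun_tilt t (y : R) : 0 <= t -> t < `|y| ->
  normal_fun 0 1 y <=
  expR (- (t ^+ 2 / 2)) * (normal_fun t 1 y + normal_fun (- t) 1 y).
Proof.
move=> t0 yt; rewrite /normal_fun mulrDr -!expRD expr1n.
have [y0|y0] := leP 0 y.
- apply: ler_wpDr; first exact: expR_ge0.
  move: yt; rewrite ger0_norm// => yt; rewrite ler_expR.
  by have : 0 <= t * (y - t) by [apply: mulr_ge0; lra]; lra.
- apply: ler_wpDl; first exact: expR_ge0.
  move: yt; rewrite ltr0_norm// => yt; rewrite ler_expR.
  by have : 0 <= t * (- y - t) by [apply: mulr_ge0; lra]; lra.
Qed.

Lemma integral_normal_prob_tail t (g : measurableTypeR R -> R) : 0 <= t ->
  measurable_fun [set: measurableTypeR R] g -> (forall y, 0 <= g y) ->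
  (forall y, `|y| <= t -> g y = 0) ->
  (\int[normal_prob 0 1]_y (g y)%:E <=
   (expR (- (t ^+ 2 / 2)))%:E * (\int[normal_prob t 1]_y (g y)%:E +
                                 \int[normal_prob (- t) 1]_y (g y)%:E))%E.
Proof.
move=> t0 mg g0 gt.
have mpdf k : measurable_fun [set: measurableTypeR R]
    (fun x => (normal_pdf k 1 x)%:E).
  apply/measurable_EFinP; exact: measurable_normal_pdf.
have mg' : measurable_fun [set: measurableTypeR R] (fun y => (g y)%:E).
  exact/measurable_EFinP.
have gp0 k x : (0 <= (g x)%:E * (normal_pdf k 1 x)%:E)%E.
  by rewrite mule_ge0// lee_fin ?normal_pdf_ge0.
rewrite !ge0_integral_normal_prob// -ge0_integralD//;
  try exact: emeasurable_funM.
rewrite -ge0_integralZl//; first last.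
- by move=> x _; rewrite adde_ge0.
- by apply: emeasurable_funD; exact: emeasurable_funM.
apply: ge0_le_integral => //.
- exact: emeasurable_funM.
- apply: emeasurable_funM => //.
  by apply: emeasurable_funD; exact: emeasurable_funM.
move=> y _; rewrite -!EFinM lee_fin -mulrDr mulrCA.
have [yt|yt] := leP `|y| t; first by rewrite gt// !mul0r.
apply: ler_wpM2l => //; rewrite !(normal_pdfE _ (oner_neq0 R)).
have p0 := @normal_peak_ge0 R 1.
rewrite -mulrDr mulrCA; apply: ler_wpM2l => //.
exact: normal_fun_tilt.
Qed.

Lemma normal_prob_tail t : 0 <= t ->
  (\int[normal_prob 0 1]_y ((t < `|y|)%R%:R)%:E <=
   (2 * expR (- (t ^+ 2 / 2)))%:E :> \bar R)%E.
Proof.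
move=> t0.
have mg : measurable_fun [set: measurableTypeR R]
    (fun y : measurableTypeR R => (t < `|y|)%R%:R : R).
  by apply: measurable_fun_natr_bool; apply: measurable_fun_ltr.
apply: le_trans (integral_normal_prob_tail t0 mg _ _) _.
- by move=> y; rewrite ler0n.
- by move=> y; rewrite leNgt => /negbTE ->.
have H k : (\int[normal_prob k 1]_y ((t < `|y|)%R%:R)%:E <= 1 :> \bar R)%E.
  apply: (@le_trans _ _ (\int[normal_prob k 1]_y (1%:E))%E); last first.
    by rewrite integral_cst// mul1e probability_le1.
  apply: ge0_le_integral => //; first exact/measurable_EFinP.
  by move=> y _; rewrite lee_fin; case: ltP.
rewrite [in leRHS]mulrC EFinM lee_wpmul2l ?lee_fin ?expR_ge0//.
by rewrite -[2%:E]/((1 + 1)%:E) EFinD; exact: leeD.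
Qed.

(** Since [|y| - t <= |y - k|] whenever [|k| <= t], the integral under each of the two tilted laws,
    centred at [t] and [- t], is at most the second moment bound 6. *)
Lemma normal_prob_soft_tail t : 0 <= t ->
  (\int[normal_prob 0 1]_y ((Num.max 0 (`|y| - t)) ^+ 2)%:E <=
   (12 * expR (- (t ^+ 2 / 2)))%:E :> \bar R)%E.
Proof.
move=> t0.
have mg : measurable_fun [set: measurableTypeR R]
    (fun y : measurableTypeR R => (Num.max 0 (`|y| - t)) ^+ 2 : R).
  apply: measurable_funX; apply: measurable_maxr => //.
  by apply: measurable_funB => //; exact: normr_measurable.
apply: le_trans (integral_normal_prob_tail t0 mg _ _) _.
- by move=> y; rewrite sqr_ge0.
- by move=> y yt; rewrite max_l ?expr0n// subr_le0.
have H k : `|k| <= t ->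
    (\int[normal_prob k 1]_y ((Num.max 0 (`|y| - t)) ^+ 2)%:E <= 6%:E
      :> \bar R)%E.
  move=> kt; apply: le_trans (integral_normal_prob_sqr_le k).
  apply: ge0_le_integral => //.
  - by move=> y _; rewrite lee_fin sqr_ge0.
  - exact/measurable_EFinP.
  - by apply/measurable_EFinP/measurable_funX/measurable_funB.
  move=> y _; rewrite lee_fin -(real_normK (num_real (y - k))).
  rewrite ler_sqr ?nnegrE ?le_max ?lexx// ge_max normr_ge0/=.
  by apply: le_trans (lerB_dist _ _); rewrite lerB.
rewrite [in leRHS]mulrC EFinM lee_wpmul2l ?lee_fin ?expR_ge0//.
have -> : (12 : R) = 6 + 6 by ring.
by rewrite EFinD; apply: leeD; apply: H; rewrite ?normrN ger0_norm.
Qed.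

End normal_prob_lemmas.

(** * The product law: rectangles, marginals, reflection of one coordinate *)

Section gaussian_lemmas.
Variables (R : realType) (n : nat).
Implicit Types (b y : n.-tuple R) (j : 'I_n).

Definition rectangle (A : 'I_n -> set R) : set (n.-tuple R) :=
  [set y | forall j, A j (tnth y j)].

Lemma measurable_rectangle A :
  (forall j, measurable (A j)) -> measurable (rectangle A).
Proof.
move=> mA; rewrite (_ : rectangle A =
    \bigcap_j ((fun y : n.-tuple R => tnth y j) @^-1` A j)).
  apply: fin_bigcap_measurable => // j _.
  by rewrite -[X in measurable X]setTI; exact: measurable_tnth.
by apply/seteqP; split => [y h j _|y h j]; exact: h.
Qed.

Lemma preimage_tnth_rectangle j (A : set R) :
  (fun y : n.-tuple R => tnth y j) @^-1` A =
  rectangle (fun k => if k == j then A else setT).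
Proof.
apply/seteqP; split => y /= h; last by have := h j; rewrite eqxx.
by move=> k; case: eqP => [->|].
Qed.

Definition rectangles : set (set (n.-tuple R)) :=
  [set rectangle A | A in [set A : 'I_n -> set R | forall j, measurable (A j)]].

Lemma measurable_tuple_rectangles :
  @measurable _ (n.-tuple R) = <<s rectangles >>.
Proof.
apply/seteqP; split; last first.
  apply: smallest_sub; first exact: sigma_algebra_measurable.
  by move=> _ [A mA <-]; exact: measurable_rectangle.
apply: smallest_sub; first exact: smallest_sigma_algebra.
rewrite -bigcup_seq => _ [j _ [A mA <-]].
apply: sub_sigma_algebra; rewrite setTI preimage_tnth_rectangle.
by eexists; last reflexivity; move=> k /=; case: ifP.
Qed.

Lemma rectangles_setI_closed : setI_closed rectangles.
Proof.
move=> _ _ [A mA <-] [B mB <-]; exists (fun j => A j `&` B j).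
  by move=> j; exact: measurableI.
by apply/seteqP; split => [y h|y [hA hB] j]; [split => j; case: (h j)|split].
Qed.

(** Rectangles are a pi-system that generates the sigma-algebra and contains the whole space. *)
Lemma rectangle_measure_unique (P Q : probability (n.-tuple R) R) :
  (forall A, (forall j, measurable (A j)) ->
    P (rectangle A) = Q (rectangle A)) ->
  forall E, measurable E -> P E = Q E.
Proof.
move=> PQ E mE; apply: (measure_unique rectangles (fun=> setT)) => //.
- exact: measurable_tuple_rectangles.
- exact: rectangles_setI_closed.
- move=> _; exists (fun=> setT); first by move=> j; exact: measurableT.
  by apply/seteqP; split.
- by apply/seteqP; split => // y _; exists 0%N.
- by move=> _ [A mA <-]; exact: PQ.
- by move=> k; exact: le_lt_trans (probability_le1 P measurableT) (ltry 1).
Qed.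

(** The preimage of a set under one coordinate is a rectangle whose other sides are full and
    contribute factors 1. *)
Lemma gaussian_marginal b j (f : R -> \bar R) :
  measurable_fun [set: R] f -> (forall x, (0 <= f x)%E) ->
  (\int[gaussian b]_y f (tnth y j) = \int[normal_prob (tnth b j) 1]_x f x)%E.
Proof.
move=> mf f0.
pose phi : n.-tuple R -> measurableTypeR R := fun y => tnth y j.
have mphi : measurable_fun [set: n.-tuple R] phi.
  by move=> mT A mA; exact: (@measurable_tnth _ R n j mT A mA).
transitivity (\int[pushforward (gaussian b) phi]_x f x)%E.
  by rewrite (@ge0_integral_pushforward _ _ _ _ _ phi mphi).
apply: eq_measure_integral => A mA _.
transitivity (gaussian b (rectangle (fun k => if k == j then A else setT))).
  by rewrite -preimage_tnth_rectangle.
rewrite gaussian_rectangle; last by move=> k; case: ifP.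
rewrite (bigD1 j)//= eqxx big1 ?mule1// => k /negbTE ->.
exact: probability_setT.
Qed.

(** Changes the sign of the noise [y_j - b_j] and fixes the other coordinates. *)
Definition reflect_coord b j y : n.-tuple R :=
  [tuple if k == j then 2 * tnth b j - tnth y j else tnth y k | k < n].

Lemma measurable_reflect_coord b j :
  measurable_fun [set: n.-tuple R] (reflect_coord b j).
Proof.
apply/measurable_fun_tnthP => k.
rewrite (_ : _ \o _ = fun y =>
    if k == j then 2 * tnth b j - tnth y j else tnth y k).
  by case: (k == j); [apply: measurable_funB => //|]; exact: measurable_tnth.
by apply/funext => y /=; rewrite tnth_mktuple.
Qed.

HB.instance Definition _ b j :=
  isMeasurableFun.Build _ _ _ _ (reflect_coord b j)
    (measurable_reflect_coord b j).

(** On a rectangle only the j-th factor changes, and a normal law is symmetric about its mean. *)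
Lemma gaussian_reflect_coord b j E : measurable E ->
  gaussian b (reflect_coord b j @^-1` E) = gaussian b E.
Proof.
apply: (rectangle_measure_unique
  (P := distribution (gaussian b) (reflect_coord b j))) => A mA.
transitivity (gaussian b (rectangle (fun k =>
    if k == j then (fun x => 2 * tnth b j - x) @^-1` A j else A k))).
  congr (gaussian b _); apply/seteqP; split => y /= h k; have := h k;
    by rewrite tnth_mktuple; case: eqP => // ->.
rewrite !gaussian_rectangle//; last first.
  move=> k; case: eqP => // _; rewrite -[X in measurable X]setTI.
  by apply: measurable_funB => //.
apply: eq_bigr => k _; case: eqP => // ->.
exact: normal_prob_reflection.
Qed.

Lemma integral_gaussian_reflect_coord b j (f : n.-tuple R -> \bar R) :
  measurable_fun [set: n.-tuple R] f -> (forall y, (0 <= f y)%E) ->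
  (\int[gaussian b]_y f (reflect_coord b j y) = \int[gaussian b]_y f y)%E.
Proof.
move=> mf f0; rewrite -[LHS](@ge0_integral_pushforward _ _ _ _ _ _
  (measurable_reflect_coord b j) (gaussian b) setT)//.
by apply: eq_measure_integral => A mA _; exact: gaussian_reflect_coord.
Qed.

End gaussian_lemmas.

(** * Clipping, the complement of soft thresholding *)

Section clip.
Variable R : realType.
Implicit Types t x : R.

(** For [t >= 0], soft thresholding at [t] is [x - clip t x]. *)
Definition clip t x : R := Num.max (- t) (Num.min t x).

Lemma clip_id t x : `|x| <= t -> clip t x = x.
Proof.
by rewrite ler_norml /clip => /andP[h1 h2]; rewrite (min_r h2) max_r.
Qed.

Lemma clip_pos t x : 0 <= t <= x -> clip t x = t.
Proof.
by move=> /andP[t0 tx]; rewrite /clip min_l// max_r//; lra.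
Qed.

Lemma clip_neg t x : 0 <= t <= - x -> clip t x = - t.
Proof.
by move=> /andP[t0 tx]; rewrite /clip min_r ?max_l//; lra.
Qed.

Lemma clip_sqr t x : 0 <= t -> clip t x ^+ 2 = Num.min (x ^+ 2) (t ^+ 2).
Proof.
move=> t0; have [xt|xt] := leP `|x| t.
  rewrite clip_id// min_l// -[x ^+ 2]real_normK ?num_real//.
  by rewrite ler_sqr ?nnegrE.
rewrite min_r; last first.
  by rewrite -[x ^+ 2]real_normK ?num_real// ler_sqr ?nnegrE// ltW.
have [x0|x0] := leP 0 x.
  by rewrite clip_pos// t0; move: xt; rewrite ger0_norm// => /ltW.
by rewrite clip_neg ?sqrrN// t0; move: xt; rewrite ltr0_norm// => /ltW.
Qed.

Lemma clip_ge0 t x : 0 <= t -> 0 <= x -> 0 <= clip t x.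
Proof. by move=> t0 x0; rewrite /clip le_max le_min t0 x0 orbT. Qed.

Lemma clip_le0 t x : 0 <= t -> x <= 0 -> clip t x <= 0.
Proof. by move=> t0 x0; rewrite /clip ge_max oppr_le0 t0 ge_min x0 orbT. Qed.

Lemma sub_clip_norm t x : 0 <= t -> `|x - clip t x| = Num.max 0 (`|x| - t).
Proof.
move=> t0; have [xt|xt] := leP `|x| t.
  by rewrite clip_id// subrr normr0 max_l// subr_le0.
rewrite max_r; last by rewrite subr_ge0 ltW.
have [x0|x0] := leP 0 x.
  move: xt; rewrite ger0_norm// => xt.
  by rewrite clip_pos ?t0 ?ltW// ger0_norm// subr_ge0 ltW.
move: xt; rewrite ltr0_norm// => xt.
by rewrite clip_neg ?t0 ?ltW// ler0_norm; lra.
Qed.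

Lemma sub_clip_eq0 t x : 0 <= t -> (x - clip t x == 0) = (x ^+ 2 <= t ^+ 2).
Proof.
move=> t0; rewrite -normr_eq0 sub_clip_norm//.
rewrite -[x ^+ 2]real_normK ?num_real// ler_sqr ?nnegrE//.
have [xt|xt] := leP `|x| t; first by rewrite max_l ?eqxx// subr_le0.
by rewrite max_r ?subr_ge0 ?ltW// subr_eq0 gt_eqF.
Qed.

End clip.

(** * The estimator with data-driven threshold and its deterministic bounds *)

Section adaptive_soft_threshold.
Variables (R : realType) (n s : nat) (A : R).
Hypotheses (A0 : 0 <= A) (s0 : (0 < s)%N).
Implicit Types (b y : n.-tuple R) (i : nat) (j : 'I_n).

(* Squared thresholds; level i may be used only when at least s / 2^i
   coordinates exceed it. *)
Definition level i : R := A + 4 * i%:R.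

Definition exceed i y : nat := #|[pred j | level i < tnth y j ^+ 2]|.

Definition passes i y : bool := (s <= 2 ^ i * exceed i y)%N.

(** Levels increase with [i], so this is the first level that passes. The default [level s] needs no
    test: as [s <= 2 ^ s], a single coordinate beyond it is enough to pass. *)
Definition sqthr y : R :=
  \big[Num.min/level s]_(i < s | passes i y) level i.

Definition clipped y j : R := clip (Num.sqrt (sqthr y)) (tnth y j).

Definition soft_estimator y : n.-tuple R :=
  [tuple tnth y j - clipped y j | j < n].

Lemma level_ge0 i : 0 <= level i.
Proof. by rewrite addr_ge0// mulr_ge0. Qed.

Lemma sqthr_ge y : A <= sqthr y.
Proof.
have lA i : A <= level i by rewrite lerDl mulr_ge0.
by apply: le_bigmin.
Qed.

Lemma sqthr_ge0 y : 0 <= sqthr y.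
Proof. exact: le_trans A0 (sqthr_ge y). Qed.

Lemma sqthr_le i y : (i <= s)%N -> (i = s) \/ passes i y -> sqthr y <= level i.
Proof.
rewrite leq_eqVlt => /orP[/eqP-> _|]; first exact: bigmin_le_id.
move=> ils [is_|pi]; first by rewrite is_ ltnn in ils.
exact: (@bigmin_le_cond _ _ _ _ (Ordinal ils) (fun i : 'I_s => passes i y)
  (fun i : 'I_s => level i)).
Qed.

Lemma sqthrP y : exists i, [/\ (i <= s)%N, sqthr y = level i
  & (i = s) \/ passes i y].
Proof.
rewrite /sqthr; elim/big_ind: _.
- by exists s; split => //; left.
- move=> u v [i [hi1 hi2 hi3]] [k [hk1 hk2 hk3]].
  by case: (leP u v) => _; [exists i|exists k].
- by move=> i pi; exists i; split; [exact: ltnW| |right].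
Qed.

Lemma clipped_sqr y j : clipped y j ^+ 2 = Num.min (tnth y j ^+ 2) (sqthr y).
Proof. by rewrite clip_sqr ?sqrtr_ge0// sqr_sqrtr// sqthr_ge0. Qed.

Lemma soft_estimator_neq0 y j :
  (tnth (soft_estimator y) j != 0) = (sqthr y < tnth y j ^+ 2).
Proof.
rewrite tnth_mktuple sub_clip_eq0 ?sqrtr_ge0//.
by rewrite sqr_sqrtr ?sqthr_ge0// -ltNge.
Qed.

(** The selected threshold is never below [Num.sqrt A], and a larger threshold shrinks more. *)
Lemma soft_estimator_sqr_le y j : tnth (soft_estimator y) j ^+ 2 <=
  Num.max 0 (`|tnth y j| - Num.sqrt A) ^+ 2.
Proof.
have M0 (u : R) : 0 <= Num.max 0 u by rewrite le_max lexx.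
rewrite tnth_mktuple -[leLHS]real_normK ?num_real//.
rewrite sub_clip_norm ?sqrtr_ge0// ler_sqr ?nnegrE ?M0//.
have uv := ler_wsqrtr (sqthr_ge y).
by rewrite ge_max !le_max lexx/= orbC lerB.
Qed.

(* A coordinate that moves outwards can lower the threshold only down to its
   own previous position. *)
Lemma clipped_sqr_homo y y' j :
  (forall k, k != j -> tnth y k = tnth y' k) ->
  tnth y j ^+ 2 <= tnth y' j ^+ 2 -> clipped y j ^+ 2 <= clipped y' j ^+ 2.
Proof.
move=> yy' yj; rewrite !clipped_sqr le_min !ge_min yj/=.
have [//|lt] := leP (sqthr y) (sqthr y'); first by rewrite orbT.
have [i [ils ei pi]] := sqthrP y'.
(* If [y_j^2] were beyond the level [i] selected at [y'], then so would be the larger [y'_j^2]; both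
   points would have the same count at level [i], making it available at [y] too, against [lt]. *)
rewrite orbF ei leNgt; apply/negP => yi.
suff : sqthr y <= level i by rewrite leNgt -ei lt.
apply: sqthr_le => //; case: pi => [->|pi]; [by left|right].
rewrite /passes (_ : exceed i y = exceed i y')//.
apply: eq_card => k; rewrite !inE; have [->|kj] := eqVneq k j.
  by rewrite yi (lt_le_trans yi).
by rewrite yy'.
Qed.

(** [clipped] has the sign of its coordinate. For equal signs it suffices to compare squares, with
    [y] and [y'] exchanged on the negative side; opposite signs are compared through 0. *)
Lemma clipped_homo y y' j :
  (forall k, k != j -> tnth y k = tnth y' k) ->
  tnth y j <= tnth y' j -> clipped y j <= clipped y' j.
Proof.
move=> yy' yj; have [y0|y0] := leP 0 (tnth y j).
- have y'0 := le_trans y0 yj.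
  have := @clipped_sqr_homo _ _ _ yy'.
  by rewrite !ler_sqr ?nnegrE ?clip_ge0 ?sqrtr_ge0//; exact.
- have [y'0|y'0] := leP (tnth y' j) 0; last first.
    apply: (@le_trans _ _ 0); first by rewrite clip_le0 ?sqrtr_ge0 ?ltW.
    by rewrite clip_ge0 ?sqrtr_ge0 ?ltW.
  have y'y k : k != j -> tnth y' k = tnth y k by move=> /yy' ->.
  have := @clipped_sqr_homo _ _ _ y'y.
  rewrite -(sqrrN (tnth y' j)) -(sqrrN (tnth y j)).
  rewrite -(sqrrN (clipped y' j)) -(sqrrN (clipped y j)).
  rewrite !ler_sqr ?nnegrE ?oppr_ge0 ?clip_le0 ?sqrtr_ge0 ?(ltW y0)//.
  by rewrite !lerN2; exact.
Qed.

(** Layer-cake bound: each level that [u] crosses adds at most the spacing 4. *)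
Lemma min_level_le (u : R) m : Num.min u (level m) <=
  A + 4 * \sum_(i < m) (level i < u)%R%:R.
Proof.
elim: m => [|m IHm].
  by rewrite big_ord0 /level !mulr0 addr0 ge_min lexx orbT.
rewrite big_ord_recr /= mulrDr addrA.
have lm : level m.+1 = level m + 4 by rewrite /level -natr1; ring.
have [mu|um] := ltP (level m) u; last first.
  rewrite mulr0 addr0; apply: le_trans IHm.
  by rewrite le_min !ge_min lexx um.
rewrite mulr1; apply: (@le_trans _ _ (Num.min u (level m) + 4)); last first.
  by rewrite lerD2r.
by rewrite (min_r (ltW mu)) -lm ge_min lexx orbT.
Qed.

Lemma sum_expf_half m : \sum_(i < m) (2^-1 : R) ^+ i <= 2.
Proof.
suff -> : \sum_(i < m) (2^-1 : R) ^+ i = 2 - 2 * 2^-1 ^+ m.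
  by rewrite gerDl oppr_le0 mulr_ge0// exprn_ge0// invr_ge0.
elim: m => [|m IHm]; first by rewrite big_ord0 expr0 mulr1 subrr.
by rewrite big_ord_recr/= IHm exprS; field.
Qed.

(** The 8 is the spacing 4 times the bound 2 on the geometric series of the counts [s / 2^i]. *)
Lemma sum_clipped_sqr_le b y : (l0norm b <= s)%N ->
  \sum_(j < n | tnth b j != 0) clipped y j ^+ 2 <= s%:R * (A + 8).
Proof.
move=> bs; have [m [ms em pm]] := sqthrP y.
apply: (@le_trans _ _ (\sum_(j < n | tnth b j != 0)
  (A + 4 * \sum_(i < m) (level i < tnth y j ^+ 2)%R%:R))).
  by apply: ler_sum => j _; rewrite clipped_sqr em min_level_le.
rewrite big_split/= mulrDr lerD//.
  rewrite sumr_const -[leLHS]mulr_natl ler_wpM2r// ler_nat.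
  exact: leq_trans bs.
rewrite -mulr_sumr exchange_big/=.
have exc (i : 'I_m) :
    \sum_(j < n | tnth b j != 0) (level i < tnth y j ^+ 2)%R%:R
    <= s%:R * 2^-1 ^+ i :> R.
  apply: (@le_trans _ _ (exceed i y)%:R).
    rewrite big_mkcond/= /exceed -sum1_card natr_sum big_mkcond/=.
    rewrite [leRHS]big_mkcond/=.
    by apply: ler_sum => j _; rewrite !inE; case: ifP => //; case: ifP.
  rewrite exprVn ler_pdivlMr ?exprn_gt0// mulrC -natrX -natrM ler_nat.
  (* A level [i < m] cannot pass, since the selected threshold would then be at most
     [level i < level m]; failing means that fewer than [s / 2^i] coordinates exceed it. *)
  apply: ltnW; rewrite ltnNge; apply/negP => pi.
  have : sqthr y <= level i.
    apply: sqthr_le; first exact: leq_trans (ltnW (ltn_ord i)) ms.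
    by right.
  by rewrite em /level lerD2l ler_pM2l// ler_nat leqNgt ltn_ord.
apply: (@le_trans _ _ (4 * \sum_(i < m) s%:R * 2^-1 ^+ i)).
  by rewrite ler_pM2l//; apply: ler_sum => i _; exact: exc.
rewrite -mulr_sumr mulrCA ler_wpM2l//.
have -> : (8 : R) = 4 * 2 by ring.
by rewrite ler_pM2l// sum_expf_half.
Qed.

Lemma FDP_soft_estimator_le b y : FDP b (soft_estimator y) <=
  \sum_(i < s.+1) \sum_(j < n | tnth b j == 0)
    2 ^+ i / s%:R * (level i < tnth y j ^+ 2)%R%:R.
Proof.
have sR : (0 : R) < s%:R by rewrite ltr0n.
have term0 (i : nat) : 0 <= \sum_(j < n | tnth b j == 0)
    2 ^+ i / s%:R * (level i < tnth y j ^+ 2)%R%:R :> R.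
  by apply: sumr_ge0 => j _; rewrite mulr_ge0// divr_ge0// ?exprn_ge0.
have [m [ms em pm]] := sqthrP y.
have eN : (FP b (soft_estimator y) + TP b (soft_estimator y) = exceed m y)%N.
  rewrite /FP /TP /exceed -em.
  rewrite -(cardID [pred j | tnth b j == 0] [pred j | sqthr y < tnth y j ^+ 2]).
  congr (_ + _)%N; apply: eq_card => j; rewrite !inE soft_estimator_neq0//.
  by rewrite andbC.
have eF : (FP b (soft_estimator y))%:R =
    \sum_(j < n | tnth b j == 0) (level m < tnth y j ^+ 2)%R%:R :> R.
  rewrite /FP -sum1_card natr_sum big_mkcond/= [RHS]big_mkcond/=.
  apply: eq_bigr => j _; rewrite !inE soft_estimator_neq0 em.
  by case: (_ < _); case: (_ == _).
rewrite /FDP eN.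
(* Without discoveries the quotient is 0 by the convention on division. *)
have [e0|e0] := posnP (exceed m y); first by rewrite e0 invr0 mulr0 sumr_ge0.
(* For the default level [m = s] passing is not recorded, but follows from [s <= 2 ^ s] and one
   discovery. *)
have pass : passes m y.
  case: pm => // ms'; rewrite /passes ms'.
  rewrite (leq_trans (ltnW (ltn_expl s (ltnSn 1))))//.
  by rewrite -[leqLHS]muln1 leq_mul2l -ms' e0 orbT.
(* Of the nonnegative sum over levels only the term of the selected one is kept. *)
rewrite (bigD1 (Ordinal (ms : m < s.+1)%N))//= ler_wpDr ?sumr_ge0//.
rewrite -mulr_sumr -eF mulrC ler_wpM2r//.
rewrite ler_pdivlMr// mulrC ler_pdivrMr ?ltr0n//.
by rewrite -natrX -natrM ler_nat.
Qed.

End adaptive_soft_threshold.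

(** * Measurability of counts and minima; integrals of finite sums *)

Section measurability.
Context d (T : measurableType d) (R : realType).

Lemma measurable_fun_card m (P : 'I_m -> T -> bool) :
  (forall j, measurable_fun [set: T] (P j)) ->
  measurable_fun [set: T] (fun x => #|[pred j | P j x]|).
Proof.
move=> mP; rewrite (_ : (fun x => _) =
    fun x => (\sum_(j <- index_enum 'I_m) (if P j x then 1 else 0))%N).
  elim: (index_enum _) => [|j r IHr].
    rewrite (_ : (fun x => _) = cst 0%N)//.
    by apply/funext => x; rewrite big_nil.
  rewrite (_ : (fun x => _) = fun x => ((if P j x then 1 else 0) +
      \sum_(k <- r) (if P k x then 1 else 0))%N); last first.
    by apply/funext => x; rewrite big_cons.
  by apply: measurable_fun_addn => //; exact: measurable_fun_ifT.
by apply/funext => x; rewrite -sum1_card big_mkcond.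
Qed.

Lemma measurable_fun_bigmin (I : Type) (r : seq I) (P : I -> T -> bool) (c : R)
    (F : I -> R) : (forall i, measurable_fun [set: T] (P i)) ->
  measurable_fun [set: T] (fun x => \big[Num.min/c]_(i <- r | P i x) F i).
Proof.
move=> mP; elim: r => [|i r IHr].
  by rewrite (_ : (fun x => _) = cst c)//; apply/funext => x; rewrite big_nil.
rewrite (_ : (fun x => _) = fun x =>
    if P i x then Num.min (F i) (\big[Num.min/c]_(k <- r | P k x) F k)
    else \big[Num.min/c]_(k <- r | P k x) F k); last first.
  by apply/funext => x; rewrite big_cons.
by apply: measurable_fun_ifT => //; exact: measurable_minr.
Qed.

Lemma measurable_fun_nat (g : nat -> R) (f : T -> nat) :
  measurable_fun [set: T] f -> measurable_fun [set: T] (g \o f).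
Proof. by move=> mf; apply: measurableT_comp. Qed.

Lemma integral_EFin_sum (mu : {measure set T -> \bar R}) (I : finType)
    (P : pred I) (f : I -> T -> R) :
  (forall i, measurable_fun [set: T] (f i)) -> (forall i x, 0 <= f i x) ->
  (\int[mu]_x (\sum_(i | P i) f i x)%:E =
   \sum_(i | P i) \int[mu]_x (f i x)%:E)%E.
Proof.
move=> mf f0; rewrite -[RHS]big_filter.
rewrite -(@ge0_integral_sum _ _ _ mu _ measurableT _ (fun i x => (f i x)%:E)).
- by apply: eq_integral => x _; rewrite big_filter sumEFin.
- by move=> i; exact/measurable_EFinP.
- by move=> i x _; rewrite lee_fin.
Qed.

End measurability.

(** Stated for extended reals so that symmetrization requires no integrability. *)
Lemma lee_double (R : realType) (x y : \bar R) :
  (x + x <= y + y)%E -> (x <= y)%E.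
Proof.
case: x y => [x| |] [y| |]//=; rewrite ?leey ?leNye//.
by rewrite -!EFinD !lee_fin; lra.
Qed.

(** * Bounds in expectation: FDP and symmetrization *)

Section expectations.
Variables (R : realType) (n : nat).
Implicit Types (b y : n.-tuple R) (bhat : n.-tuple R -> n.-tuple R) (j : 'I_n).

Lemma measurable_FDP b bhat : measurable_fun [set: n.-tuple R] bhat ->
  measurable_fun [set: n.-tuple R] (fun y => FDP b (bhat y)).
Proof.
move=> mbhat.
have mneq0 j : measurable_fun [set: n.-tuple R] (fun y => tnth (bhat y) j != 0).
  apply: measurable_neg; apply: measurable_fun_eqr => //.
  exact: (measurable_fun_tnthP _).1.
have mcard (c : 'I_n -> bool) : measurable_fun [set: n.-tuple R]
    (fun y => #|[pred j | (tnth (bhat y) j != 0) && c j]|).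
  by apply: measurable_fun_card => j; exact: measurable_and.
apply: measurable_funM.
  by apply: (measurable_fun_nat (fun k => k%:R)); exact: mcard.
apply: (measurable_fun_nat (fun k => k%:R^-1)).
by apply: measurable_fun_addn; exact: mcard.
Qed.

Lemma FDP_ge0 b y : 0 <= FDP b y.
Proof. by rewrite divr_ge0. Qed.

Lemma FDP_le1 b y : FDP b y <= 1.
Proof.
rewrite /FDP; have [->|h] := posnP (FP b y + TP b y)%N.
  by rewrite invr0 mulr0.
by rewrite ler_pdivrMr ?ltr0n// mul1r ler_nat leq_addr.
Qed.

Lemma FDR_le1 b bhat : measurable_fun [set: n.-tuple R] bhat ->
  (FDR b bhat <= 1)%E.
Proof.
move=> mbhat; rewrite /FDR unlock.
apply: (@le_trans _ _ (\int[gaussian b]_y (1%:E))%E); last first.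
  by rewrite integral_cst// mul1e probability_le1.
apply: ge0_le_integral => //.
- by move=> y _; rewrite lee_fin FDP_ge0.
- by apply/measurable_EFinP; exact: measurable_FDP.
- by move=> y _; rewrite lee_fin FDP_le1.
Qed.

(** The law is invariant under the reflection, so twice each integral is the integral of the
    symmetrized function. *)
Lemma le_integral_gaussian_symmetrized b j (f g : n.-tuple R -> R) :
  measurable_fun [set: n.-tuple R] f -> (forall y, 0 <= f y) ->
  measurable_fun [set: n.-tuple R] g -> (forall y, 0 <= g y) ->
  (forall y, f y + f (reflect_coord b j y) <= g y + g (reflect_coord b j y)) ->
  (\int[gaussian b]_y (f y)%:E <= \int[gaussian b]_y (g y)%:E)%E.
Proof.
move=> mf f0 mg g0 fg; apply: lee_double.
have mr (h : n.-tuple R -> R) : measurable_fun [set: n.-tuple R] h ->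
    measurable_fun [set: n.-tuple R] (fun y => (h (reflect_coord b j y))%:E).
  move=> mh; apply/measurable_EFinP.
  by apply: (measurableT_comp mh); exact: measurable_reflect_coord.
have e0 (h : n.-tuple R -> R) : (forall y, 0 <= h y) ->
  forall y, (0 <= (h y)%:E)%E by move=> h0 y; rewrite lee_fin.
have mE (h : n.-tuple R -> R) : measurable_fun [set: n.-tuple R] h ->
    measurable_fun [set: n.-tuple R] (fun y => (h y)%:E).
  by move=> mh; exact/measurable_EFinP.
rewrite -{2}(integral_gaussian_reflect_coord b j (mE _ mf) (e0 _ f0)).
rewrite -{2}(integral_gaussian_reflect_coord b j (mE _ mg) (e0 _ g0)).
rewrite -!ge0_integralD//;
  try by [exact: mE|exact: mr|move=> y _; rewrite lee_fin].
apply: ge0_le_integral => //.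
- by move=> y _; rewrite -EFinD lee_fin addr_ge0.
- by apply: emeasurable_funD; [exact: mE|exact: mr].
- by apply: emeasurable_funD; [exact: mE|exact: mr].
- by move=> y _; rewrite -!EFinD lee_fin.
Qed.

(** * FDR and risk of the adaptive soft threshold *)

Variables (s : nat) (A : R).
Hypotheses (A0 : 0 <= A) (s0 : (0 < s)%N).

Lemma measurable_exceeds i j : measurable_fun [set: n.-tuple R]
  (fun y => level A i < tnth y j ^+ 2).
Proof.
apply: measurable_fun_ltr => //.
by apply: measurable_funX; exact: measurable_tnth.
Qed.

Lemma measurable_clipped j :
  measurable_fun [set: n.-tuple R] (fun y => clipped s A y j).
Proof.
have mthr : measurable_fun [set: n.-tuple R] (fun y => Num.sqrt (sqthr s A y)).
  apply: (measurableT_comp (f := @Num.sqrt R)).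
    by apply: continuous_measurable_fun; exact: sqrt_continuous.
  apply: measurable_fun_bigmin => i; rewrite /passes.
  apply: measurable_fun_leq => //.
  apply: (measurableT_comp (f := fun k => (2 ^ i * k)%N)) => //.
  by apply: measurable_fun_card => k; exact: measurable_exceeds.
apply: measurable_maxr; first exact: measurable_funN.
by apply: measurable_minr => //; exact: measurable_tnth.
Qed.

Lemma measurable_soft_estimator :
  measurable_fun [set: n.-tuple R] (@soft_estimator R n s A).
Proof.
apply/measurable_fun_tnthP => j.
rewrite (_ : _ \o _ = fun y => tnth y j - clipped s A y j); last first.
  by apply/funext => y /=; rewrite tnth_mktuple.
apply: measurable_funB; first exact: measurable_tnth.
exact: measurable_clipped.
Qed.

(** The spacing 4 gives a factor [expR (- 2) <= 1/4] per level, small enough to beat the weight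
    [2 ^ i] in the FDP bound. *)
Lemma gaussian_exceeds_le b i j : tnth b j = 0 ->
  (\int[gaussian b]_y ((level A i < tnth y j ^+ 2)%R%:R)%:E <=
   (2 * expR (- (A / 2)) * 4^-1 ^+ i)%:E :> \bar R)%E.
Proof.
move=> bj.
rewrite (@gaussian_marginal R n b j
  (fun x : R => ((level A i < x ^+ 2)%R%:R)%:E)); last 2 first.
- apply/measurable_EFinP/measurable_fun_natr_bool.
  by apply: measurable_fun_ltr => //; exact: measurable_funX.
- by move=> x; rewrite lee_fin.
have l0 := level_ge0 A0 i.
rewrite bj; under eq_integral => x _.
  rewrite (_ : (level A i < x ^+ 2)%R = (Num.sqrt (level A i) < `|x : R|)%R);
    last first.
    rewrite -[in LHS](sqr_sqrtr l0) -(real_normK (num_real x)).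
    by rewrite ltr_sqr// nnegrE sqrtr_ge0.
  over.
apply: le_trans (normal_prob_tail (sqrtr_ge0 _)) _.
rewrite sqr_sqrtr// lee_fin -mulrA ler_pM2l//.
have -> : - (level A i / 2) = - (A / 2) + i%:R * (- 2) by rewrite /level; field.
rewrite expRD ler_pM2l ?expR_gt0// expRM_natl lerXn2r ?nnegrE ?expR_ge0//.
rewrite expRN lef_pV2 ?posrE ?expR_gt0//.
have -> : (2 : R) = 1 + 1 by []; rewrite expRD.
have -> : (4 : R) = 2 * 2 by ring.
have e2 : (2 : R) <= expR 1 by have := expR_ge1Dx (1 : R).
by apply: ler_pM.
Qed.

Lemma FDR_soft_estimator_le b : (FDR b (@soft_estimator R n s A) <=
  (4 * (n%:R / s%:R) * expR (- (A / 2)))%:E)%E.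
Proof.
have sR : (0 : R) < s%:R by rewrite ltr0n.
have k0 i : (0 : R) <= 2 ^+ i / s%:R by rewrite divr_ge0// exprn_ge0.
have mt i j : measurable_fun [set: n.-tuple R]
    (fun y => 2 ^+ i / s%:R * (level A i < tnth y j ^+ 2)%R%:R : R).
  apply: measurable_funM => //.
  by apply: measurable_fun_natr_bool; exact: measurable_exceeds.
rewrite /FDR unlock.
apply: (@le_trans _ _ (\int[gaussian b]_y (\sum_(i < s.+1)
    \sum_(j < n | tnth b j == 0)
      2 ^+ i / s%:R * (level A i < tnth y j ^+ 2)%R%:R)%:E)%E).
  apply: ge0_le_integral => //.
  - by move=> y _; rewrite lee_fin FDP_ge0.
  - apply/measurable_EFinP; apply: measurable_FDP.
    exact: measurable_soft_estimator.
  - apply/measurable_EFinP; apply: measurable_sum => i.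
    by under eq_fun do rewrite -big_filter; exact: measurable_sum.
  - by move=> y _; rewrite lee_fin; exact: FDP_soft_estimator_le.
rewrite integral_EFin_sum; last 2 first.
- by move=> i; under eq_fun do rewrite -big_filter; exact: measurable_sum.
- by move=> i y; apply: sumr_ge0 => j _; rewrite mulr_ge0.
pose E : R := expR (- (A / 2)); rewrite -/E.
have E0 : 0 <= E by exact: expR_ge0.
(* Each of at most [n] nulls contributes [2^i / s * 2 E * 4^-i] at level [i]; the resulting series
   in [2^-i] is at most 2, whence the factor 4. *)
apply: (@le_trans _ _ (\sum_(i < s.+1)
    (n%:R * (2 * E / s%:R) * 2^-1 ^+ i)%:E)%E); last first.
  rewrite sumEFin lee_fin -mulr_sumr.
  apply: (@le_trans _ _ (n%:R * (2 * E / s%:R) * 2)).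
    by rewrite ler_wpM2l ?sum_expf_half// mulr_ge0// divr_ge0// mulr_ge0.
  by rewrite le_eqVlt; apply/orP; left; apply/eqP; field; rewrite gt_eqF.
apply: lee_sum => i _.
rewrite integral_EFin_sum; last 2 first.
- by move=> j; exact: mt.
- by move=> j y; rewrite mulr_ge0.
apply: (@le_trans _ _ (\sum_(j < n | (tnth b j == 0)%R)
    (2 * E / s%:R * 2^-1 ^+ i)%:E)%E); last first.
  rewrite sumEFin lee_fin sumr_const -[leLHS]mulr_natl -[leRHS]mulrA.
  rewrite ler_wpM2r//.
    by rewrite mulr_ge0 ?exprn_ge0 ?divr_ge0 ?mulr_ge0 ?invr_ge0.
  by rewrite ler_nat (leq_trans (max_card _))// card_ord.
apply: lee_sum => j /eqP bj.
under eq_integral do rewrite EFinM.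
rewrite ge0_integralZl//; last first.
  apply/measurable_EFinP.
  by apply: measurable_fun_natr_bool; exact: measurable_exceeds.
apply: (le_trans (lee_wpmul2l _ (gaussian_exceeds_le i bj))).
  by rewrite lee_fin.
rewrite -EFinM lee_fin le_eqVlt; apply/orP; left; apply/eqP.
rewrite -/E (_ : 4^-1 = 2^-1 * 2^-1 :> R); last by field.
have pq : (2 : R) ^+ i * 2^-1 ^+ i = 1 by rewrite -exprMn divff// expr1n.
rewrite exprMn; transitivity (2 ^+ i * 2^-1 ^+ i * (2 * E / s%:R * 2^-1 ^+ i)).
  by ring.
by rewrite pq mul1r.
Qed.

(** At a null the estimate is dominated by soft thresholding at the fixed value [Num.sqrt A], which
    depends on [y_j] alone. *)
Lemma risk_null_le b j : tnth b j = 0 ->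
  (\int[gaussian b]_y ((tnth b j - tnth (soft_estimator s A y) j) ^+ 2)%:E <=
   (12 * expR (- (A / 2)))%:E)%E.
Proof.
move=> bj.
have mm : measurable_fun [set: R]
    (fun x : R => ((Num.max 0 (`|x| - Num.sqrt A)) ^+ 2)%:E).
  apply/measurable_EFinP/measurable_funX/measurable_maxr => //.
  by apply: measurable_funB => //; exact: normr_measurable.
apply: (@le_trans _ _ (\int[gaussian b]_y
    ((Num.max 0 (`|tnth y j| - Num.sqrt A)) ^+ 2)%:E)%E).
  apply: ge0_le_integral => //.
  - by move=> y _; rewrite lee_fin sqr_ge0.
  - apply/measurable_EFinP/measurable_funX/measurable_funB => //.
    by apply: (measurable_fun_tnthP _).1; exact: measurable_soft_estimator.
  - by apply: (measurableT_comp mm); exact: measurable_tnth.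
  - move=> y _; rewrite lee_fin bj sub0r sqrrN.
    exact: soft_estimator_sqr_le.
rewrite (@gaussian_marginal R n b j
  (fun x : R => ((Num.max 0 (`|x| - Num.sqrt A)) ^+ 2)%:E)) ?bj//.
by apply: le_trans (normal_prob_soft_tail (sqrtr_ge0 _)) _; rewrite sqr_sqrtr.
Qed.

(* The error is clipped - noise; since clipped is nondecreasing in its own
   coordinate, the cross term averages to something nonpositive over the
   reflection of the noise. *)
Lemma risk_signal_le b j :
  (\int[gaussian b]_y ((tnth b j - tnth (soft_estimator s A y) j) ^+ 2)%:E <=
   6%:E + \int[gaussian b]_y (clipped s A y j ^+ 2)%:E)%E.
Proof.
have mclip := measurable_clipped j.
have mnoise : measurable_fun [set: n.-tuple R]
    (fun y => (tnth y j - tnth b j) ^+ 2).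
  apply: measurable_funX; apply: measurable_funB => //.
  exact: measurable_tnth.
apply: (@le_trans _ _ (\int[gaussian b]_y
    ((tnth y j - tnth b j) ^+ 2 + clipped s A y j ^+ 2)%:E)%E).
  apply: (@le_integral_gaussian_symmetrized b j).
  - apply: measurable_funX; apply: measurable_funB => //.
    by apply: (measurable_fun_tnthP _).1; exact: measurable_soft_estimator.
  - by move=> y; rewrite sqr_ge0.
  - by apply: measurable_funD => //; exact: measurable_funX.
  - by move=> y; rewrite addr_ge0// sqr_ge0.
  move=> y; rewrite !tnth_mktuple eqxx.
  set y' := reflect_coord b j y.
  have yy' k : k != j -> tnth y k = tnth y' k.
    by move=> /negbTE kj; rewrite tnth_mktuple kj.
  have y'j : tnth y' j = 2 * tnth b j - tnth y j by rewrite tnth_mktuple eqxx.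
  set c := clipped s A y j; set c' := clipped s A y' j.
  set u := tnth y j; set v := tnth b j.
  (* The errors at [y] and [y'] are [c - (u - v)] and [c' + (u - v)]; their squares add up to [c^2 +
     c'^2 + 2 (u - v)^2 - 2 (u - v) (c - c')]. *)
  have : 0 <= (u - v) * (c - c').
    have [uv|uv] := leP v u.
      apply: mulr_ge0; rewrite subr_ge0// /c /c'; apply: (clipped_homo s A0).
        by move=> k kj; rewrite yy'.
      by rewrite y'j -/u -/v; lra.
    rewrite mulr_le0 ?subr_le0//; first exact: ltW.
    by rewrite /c /c'; apply: (clipped_homo s A0) => //;
      rewrite y'j -/u -/v; lra.
  by move=> h; nra.
under eq_integral do rewrite EFinD.
rewrite ge0_integralD//; last 4 first.
- by move=> y _; rewrite lee_fin sqr_ge0.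
- exact/measurable_EFinP.
- by move=> y _; rewrite lee_fin sqr_ge0.
- by apply/measurable_EFinP; exact: measurable_funX.
apply: leeD => //.
rewrite (@gaussian_marginal R n b j (fun x : R => ((x - tnth b j) ^+ 2)%:E)).
- exact: integral_normal_prob_sqr_le.
- by apply/measurable_EFinP/measurable_funX/measurable_funB.
- by move=> x; rewrite lee_fin sqr_ge0.
Qed.

(** The 14 is 6 per signal for the noise plus the 8 from the clipped squares. *)
Lemma risk_soft_estimator_le b : (l0norm b <= s)%N ->
  (risk b (@soft_estimator R n s A) <=
   (s%:R * (A + 14) + n%:R * (12 * expR (- (A / 2))))%:E)%E.
Proof.
move=> bs; rewrite /risk unlock /sqdist integral_EFin_sum; last 2 first.
- move=> j; apply: measurable_funX; apply: measurable_funB => //.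
  by apply: (measurable_fun_tnthP _).1; exact: measurable_soft_estimator.
- by move=> j y; rewrite sqr_ge0.
rewrite (bigID (fun j => tnth b j != 0))/= EFinD; apply: leeD; last first.
  apply: (@le_trans _ _ (\sum_(j < n | ~~ (tnth b j != 0)%R)
      (12 * expR (- (A / 2)))%:E)%E).
    by apply: lee_sum => j; rewrite negbK => /eqP bj; exact: risk_null_le.
  rewrite sumEFin lee_fin sumr_const -[leLHS]mulr_natl ler_wpM2r//.
  by rewrite ler_nat (leq_trans (max_card _))// card_ord.
apply: (@le_trans _ _ (\sum_(j < n | (tnth b j != 0)%R)
    (6%:E + \int[gaussian b]_y (clipped s A y j ^+ 2)%:E))%E).
  by apply: lee_sum => j _; exact: risk_signal_le.
rewrite big_split/= sumEFin sumr_const -integral_EFin_sum; last 2 first.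
- by move=> j; apply: measurable_funX; exact: measurable_clipped.
- by move=> j y; rewrite sqr_ge0.
have -> : s%:R * (A + 14) = s%:R * 6 + s%:R * (A + 8) :> R by ring.
rewrite EFinD; apply: leeD.
  by rewrite lee_fin -[leLHS]mulr_natl ler_wpM2r// ler_nat (leq_trans _ bs).
apply: (@le_trans _ _ (\int[gaussian b]_y (s%:R * (A + 8))%:E)%E); last first.
  rewrite integral_cst// -[leRHS]mule1; apply: lee_wpmul2l.
    by rewrite lee_fin mulr_ge0// addr_ge0.
  exact: probability_le1.
apply: ge0_le_integral => //.
- by move=> y _; rewrite lee_fin sumr_ge0// => j _; rewrite sqr_ge0.
- apply/measurable_EFinP; under eq_fun do rewrite -big_filter.
  apply: measurable_sum => j; apply: measurable_funX.
  exact: measurable_clipped.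
- by move=> y _; rewrite lee_fin; exact: sum_clipped_sqr_le.
Qed.

End expectations.

(** * Choice of constants and the final bound *)

(* With A = c1 * log (n / s) - 15 the excess 14 s of the risk over s * A and the
   contribution of the nulls, at most s, fit in the budget. *)
Lemma soft_estimator_optimal (R : realType) (n s : nat) (c1 : R) :
  let L := ln (n%:R / s%:R) in
  (1 <= s <= n)%N -> 2 < c1 -> 15 <= c1 * L ->
  ln 12 + 15 / 2 <= (c1 - 2) / 2 * L ->
  exists2 bhat, @rate_optimal R n s c1 bhat & forall b,
    (FDR b bhat <= (4 * expR (15 / 2) * expR (- ((c1 - 2) / 2 * L)))%:E)%E.
Proof.
move=> L /andP[s1 sn] hc1 c1L hL.
have sR : (0 : R) < s%:R by rewrite ltr0n.
have nR : (0 : R) < n%:R by rewrite ltr0n (leq_trans s1).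
have eL : expR L = n%:R / s%:R by rewrite lnK// posrE divr_gt0.
pose A := c1 * L - 15.
have A0 : 0 <= A by rewrite subr_ge0.
have eA : n%:R / s%:R * expR (- (A / 2)) =
    expR (15 / 2) * expR (- ((c1 - 2) / 2 * L)).
  by rewrite -eL -!expRD; congr expR; rewrite /A; field.
exists (@soft_estimator R n s A); last first.
  move=> b; apply: le_trans (FDR_soft_estimator_le A0 s1 b) _.
  by rewrite lee_fin -[leLHS]mulrA eA mulrA.
split; first exact: measurable_soft_estimator.
apply: ge_ereal_sup => _ [b bs <-].
apply: le_trans (risk_soft_estimator_le A0 bs) _; rewrite lee_fin.
(* This is the exponential form of the lower bound [hL]; it makes the risk of the nulls at most
   [s]. *)
have h : 12 * expR (15 / 2) * expR (- ((c1 - 2) / 2 * L)) <= 1 :> R.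
  have -> : (12 : R) = expR (ln 12) by rewrite lnK// posrE.
  by rewrite -!expRD -[leRHS]expR0 ler_expR; lra.
have -> : n%:R * (12 * expR (- (A / 2))) =
    s%:R * (12 * expR (15 / 2) * expR (- ((c1 - 2) / 2 * L))).
  by rewrite -[12 * _ * _]mulrA -eA; field; rewrite gt_eqF.
rewrite -mulrDr [c1 * s%:R]mulrC -[leRHS]mulrA ler_wpM2l ?(ltW sR)//.
by rewrite -/L /A; lra.
Qed.

Theorem theorem2p4 (R : realType) (s : nat -> nat) (zeta c1 : R)
    (hs : forall n : nat, (1 <= n)%N -> (1 <= s n <= n)%N)
    (hlimsup : limn_sup (fun n : nat => (s n)%:R / n%:R : R) = zeta)
    (hzeta : 0 <= zeta < 1)
    (hc1 : 2 < c1)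
    (hne : \forall n \near \oo, @rate_optimal R n (s n) c1 !=set0) :
  exists2 C : R, 0 < C &
  exists eps : nat -> R,
    [/\ forall n : nat, 0 < eps n,
        eps n @[n --> \oo] --> (0 : R) &
        \forall n \near \oo,
          (ereal_inf [set ereal_sup [set FDR b bhat | b in @sparse R n (s n)]
                     | bhat in @rate_optimal R n (s n) c1]
           <= (C * ((s n)%:R / n%:R) `^ ((c1 - 2 - eps n) / 2))%:E)%E].
Proof.
(* Each summand secures one of the two lower bounds on [L] that the soft threshold requires. *)
pose L0 : R := 15 + (ln 12 + 15 / 2) / ((c1 - 2) / 2).
(* The first summand serves large [L], the second bounded [L]. *)
pose C : R := 4 * expR (15 / 2) + expR ((c1 - 2) / 2 * L0).
have C1 : expR ((c1 - 2) / 2 * L0) <= C.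
  by rewrite lerDr mulr_ge0// expR_ge0.
have C2 : 4 * expR (15 / 2) <= C by rewrite lerDl expR_ge0.
exists C; first exact: lt_le_trans (expR_gt0 _) C1.
exists (@harmonic R); split => [n||].
- exact: harmonic_gt0.
- exact: cvg_harmonic.
near=> n.
have n1 : (1 <= n)%N by near: n; exact: nbhs_infty_ge.
have /andP[s1 sn] := hs n n1.
have sR : (0 : R) < (s n)%:R by rewrite ltr0n.
have nR : (0 : R) < n%:R by rewrite ltr0n.
pose L : R := ln (n%:R / (s n)%:R).
have L0' : 0 <= L.
  by apply: ln_ge0; rewrite ler_pdivlMr// mul1r ler_nat.
(* The left side is [(s n / n)] to the power [(c1 - 2) / 2]; as [s n / n <= 1], the smaller exponent
   gives a larger value. *)
have pow : expR (- ((c1 - 2) / 2 * L)) <=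
    ((s n)%:R / n%:R) `^ ((c1 - 2 - harmonic n) / 2).
  rewrite /powR gt_eqF ?divr_gt0// -[_ / n%:R]invf_div lnV ?posrE ?divr_gt0//.
  rewrite -/L ler_expR; have := mulr_ge0 (ltW (@harmonic_gt0 R n)) L0'; nra.
suff [bhat ob fb] : exists2 bhat, @rate_optimal R n (s n) c1 bhat & forall b,
    (FDR b bhat <= (C * expR (- ((c1 - 2) / 2 * L)))%:E)%E.
  apply: ge_ereal_inf; eexists; first by exists bhat.
  apply: ge_ereal_sup => _ [b _ <-]; apply: (le_trans (fb b)).
  by rewrite lee_fin ler_wpM2l// (le_trans _ C1)// expR_ge0.
have [L0L|LL0] := leP L0 L.
- have c20 : 0 < (c1 - 2) / 2 by rewrite divr_gt0// subr_gt0.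
  have ln12 : 0 <= ln 12 :> R by apply: ln_ge0; rewrite ler1n.
  have q0 : 0 <= (ln 12 + 15 / 2) / ((c1 - 2) / 2).
    by rewrite divr_ge0 ?(ltW c20)// addr_ge0.
  have [||bhat ob fb] := @soft_estimator_optimal R n (s n) c1 (hs n n1) hc1.
  + by rewrite -/L; move: L0L; rewrite /L0; nra.
  + rewrite -/L [leRHS]mulrC -ler_pdivrMr//; apply: le_trans L0L.
    by rewrite /L0 lerDr.
  exists bhat => // b; apply: (le_trans (fb b)).
  by rewrite lee_fin ler_wpM2r// expR_ge0.
(* For [L < L0] the bound 1 on the FDR is enough, since [expR ((c1 - 2) / 2 * (L0 - L)) >= 1]. *)
- have [bhat ob] : @rate_optimal R n (s n) c1 !=set0 by near: n.
  exists bhat => // b; apply: le_trans (FDR_le1 _ ob.1) _.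
  rewrite lee_fin; apply: (@le_trans _ _ (expR ((c1 - 2) / 2 * L0) *
      expR (- ((c1 - 2) / 2 * L)))); last by rewrite ler_wpM2r// expR_ge0.
  rewrite -expRD -[leLHS]expR0 ler_expR -mulrBr mulr_ge0//.
    by rewrite divr_ge0// subr_ge0 ltW.
  by rewrite subr_ge0 ltW.
Unshelve. all: by end_near.
Qed.
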